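(* Let $\overline{E},\underline{E},\overline{P^{\mathrm C}},\overline{P^{\mathrm D}},\eta^{\mathrm C},\eta^{\mathrm D},\Delta$ be real parameters with $\overline{E}>\underline{E}\ge 0$, $\Delta>0$, $0<\eta^{\mathrm C},\eta^{\mathrm D}\le 1$, $0\le \overline{P^{\mathrm C}}\le \frac{1}{\eta^{\mathrm C}\Delta}(\overline{E}-\underline{E})$ and $0\le\overline{P^{\mathrm D}}\le \frac{\eta^{\mathrm D}}{\Delta}(\overline{E}-\underline{E})$. Let $S$ be the feasible set of the one-period basic storage operation mixed-integer model (BO-MIP), and let $P$ be the feasible set of the one-period linear relaxation TO-LP of the tighter operation model, both defined in the context as subsets of $\mathbb{R}^5$ in the variables $(e_{t-1},e_t,p^{\mathrm C}_t,p^{\mathrm D}_t,\delta_t)$. Then $P=\operatorname{conv}(S)$.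
   Context: Fix one time period $t$. Variables: $e_{t-1},e_t$ (state of charge at the end of periods $t-1$ and $t$), $p^{\mathrm C}_t,p^{\mathrm D}_t$ (charged and discharged power in period $t$), $\delta_t$ (charging indicator). $\operatorname{conv}$ denotes the convex hull. BO-MIP for one period: $S$ is the set of all $(e_{t-1},e_t,p^{\mathrm C}_t,p^{\mathrm D}_t,\delta_t)\in\mathbb{R}^5$ with - $e_t=e_{t-1}+\eta^{\mathrm C}p^{\mathrm C}_t\Delta-\frac{1}{\eta^{\mathrm D}}p^{\mathrm D}_t\Delta$, - $\underline{E}\le e_t\le\overline{E}$ and $\underline{E}\le e_{t-1}\le\overline{E}$, - $p^{\mathrm C}_t\le\overline{P^{\mathrm C}}\,\delta_t$, - $p^{\mathrm D}_t\le\overline{P^{\mathrm D}}(1-\delta_t)$, - $e_{t-1},e_t,p^{\mathrm C}_t,p^{\mathrm D}_t\ge 0$, - $\delta_t\in\{0,1\}$. TO-LP for one period: $P$ is the set of all $(e_{t-1},e_t,p^{\mathrm C}_t,p^{\mathrm D}_t,\delta_t)\in\mathbb{R}^5$ with - $e_t=e_{t-1}+\eta^{\mathrm C}p^{\mathrm C}_t\Delta-\frac{1}{\eta^{\mathrm D}}p^{\mathrm D}_t\Delta$, - $e_{t-1}\ge\underline{E}+\frac{1}{\eta^{\mathrm D}}p^{\mathrm D}_t\Delta$, - $e_{t-1}\le\overline{E}-\eta^{\mathrm C}p^{\mathrm C}_t\Delta$, - $p^{\mathrm C}_t\le\overline{P^{\mathrm C}}\,\delta_t$, - $p^{\mathrm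 D}_t\le\overline{P^{\mathrm D}}(1-\delta_t)$, - $e_{t-1},e_t,p^{\mathrm C}_t,p^{\mathrm D}_t\ge 0$, - $0\le\delta_t\le1$. *)

(* Defs.v *)
From HB Require Import structures.
From mathcomp Require Import all_boot all_order all_algebra.
From mathcomp Require Import boolp classical_sets reals convex.

Set Implicit Arguments.
Unset Strict Implicit.
Unset Printing Implicit Defensive.

Import Order.TTheory GRing.Theory Num.Theory.

Local Open Scope classical_set_scope.
Local Open Scope ring_scope.

Definition convex_hull (R : realType) (V : lmodType R) (A : set V) : set V :=
  smallest [set C | convex_set C] A.

(* A point (e_{t-1}, e_t, p^C_t, p^D_t, delta_t) of R^5 is a row vector whose
   coordinates 0, ..., 4 are listed in that order. *)
Definition soc_prev (R : realType) (x : 'rV[R]_5) : R := x 0 0.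
Definition soc (R : realType) (x : 'rV[R]_5) : R := x 0 1.
Definition charge (R : realType) (x : 'rV[R]_5) : R := x 0 2.
Definition discharge (R : realType) (x : 'rV[R]_5) : R := x 0 3.
Definition charging (R : realType) (x : 'rV[R]_5) : R := x 0 4.

Definition soc_balance (R : realType) (etaC etaD Delta : R) (x : 'rV[R]_5) :=
  soc x = soc_prev x + etaC * charge x * Delta
          - etaD^-1 * discharge x * Delta.

Definition power_limits (R : realType) (PC PD : R) (x : 'rV[R]_5) :=
  charge x <= PC * charging x /\ discharge x <= PD * (1 - charging x).

Definition nonnegative_operation (R : realType) (x : 'rV[R]_5) :=
  [/\ 0 <= soc_prev x, 0 <= soc x, 0 <= charge x & 0 <= discharge x].

Definition BO_MIP (R : realType) (Emax Emin PC PD etaC etaD Delta : R) :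
    set 'rV[R]_5 :=
  [set x | [/\ soc_balance etaC etaD Delta x,
               Emin <= soc x <= Emax /\ Emin <= soc_prev x <= Emax,
               power_limits PC PD x,
               nonnegative_operation x
             & charging x = 0 \/ charging x = 1]].

Definition TO_LP (R : realType) (Emax Emin PC PD etaC etaD Delta : R) :
    set 'rV[R]_5 :=
  [set x | [/\ soc_balance etaC etaD Delta x,
               soc_prev x >= Emin + etaD^-1 * discharge x * Delta /\
               soc_prev x <= Emax - etaC * charge x * Delta,
               power_limits PC PD x,
               nonnegative_operation x
             & 0 <= charging x <= 1]].

(* Main.v *)
(** Every point of TO-LP with charging indicator [d] strictly between 0 and 1
    is the mixture, with weights [d] and [1 - d], of a pure charging and a pure
    discharging operation.  The powers of these two are forced to be
    [charge / d] and [discharge / (1 - d)]; the admissible initial states of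
    charge of each form an interval, nonempty by the bounds on the power
    limits, and the two tightened inequalities of TO-LP say exactly that the
    given initial state lies in the weighted Minkowski sum of these intervals. *)
Require Import Defs.
From HB Require Import structures.
From mathcomp Require Import all_boot all_order all_algebra.
From mathcomp Require Import boolp classical_sets reals convex.
From mathcomp Require Import interval_inference.
From mathcomp Require Import ring lra.

Set Implicit Arguments.
Unset Strict Implicit.
Unset Printing Implicit Defensive.

Import Order.TTheory GRing.Theory Num.Theory.

Local Open Scope classical_set_scope.
Local Open Scope ring_scope.

Lemma ler_combination (R : realDomainType) (t a b a' b' : R) :
  0 <= t <= 1 -> a <= b -> a' <= b' ->
  t * a + (1 - t) * a' <= t * b + (1 - t) * b'.
Proof.
by case/andP=> t0 t1 ab ab'; rewrite lerD// ler_wpM2l// subr_ge0.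
Qed.

(** Taking the point at the same relative position [s] in both intervals makes the weighted sum
    sweep linearly from the least to the greatest value, hence reach [e]. *)
Lemma itv_combination (R : realFieldType) (t l h l' h' e : R) :
  0 <= t <= 1 -> l <= h -> l' <= h' ->
  t * l + (1 - t) * l' <= e <= t * h + (1 - t) * h' ->
  exists a b, [/\ l <= a <= h, l' <= b <= h' & e = t * a + (1 - t) * b].
Proof.
move=> t01 lh lh' /andP[]; have := ler_combination t01 lh lh'.
set m := t * l + _; set M := t * h + _ => mM me eM.
(* If [m = M], the relative position is undefined, but [e] equals [m] and the two lower endpoints
   serve. *)
have [eqmM|neqmM] := eqVneq m M.
  exists l, l'; rewrite !lexx lh lh'; split => //.
  by apply/eqP; rewrite -/m eq_le me eqmM eM.
have mM0 : 0 < M - m by rewrite subr_gt0 lt_neqAle neqmM mM.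
pose s := (e - m) / (M - m).
have s0 : 0 <= s by rewrite divr_ge0 ?subr_ge0.
have s1 : s <= 1 by rewrite ler_pdivrMr// mul1r lerB.
have es : e = m + s * (M - m) by rewrite divfK ?gt_eqF// addrC subrK.
exists (l + s * (h - l)), (l' + s * (h' - l')); split.
- by apply/andP; split; nra.
- by apply/andP; split; nra.
- by rewrite es /m /M; ring.
Qed.

Section Operations.
Variable R : realType.
Implicit Types x y : 'rV[R]_5.

Definition operation (e e' c d t : R) : 'rV[R]_5 :=
  \row_i nth 0 [:: e; e'; c; d; t] i.

Lemma operation_ext x y :
  soc_prev x = soc_prev y -> soc x = soc y -> charge x = charge y ->
  discharge x = discharge y -> charging x = charging y -> x = y.
Proof.
move=> h0 h1 h2 h3 h4; apply/rowP => -[[|[|[|[|[|//]]]]] lti].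
(* The destructed index and the numeral are ordinals that agree in value, hence [val_inj]. *)
- by move: h0; congr (x 0 _ = y 0 _); apply/val_inj.
- by move: h1; congr (x 0 _ = y 0 _); apply/val_inj.
- by move: h2; congr (x 0 _ = y 0 _); apply/val_inj.
- by move: h3; congr (x 0 _ = y 0 _); apply/val_inj.
- by move: h4; congr (x 0 _ = y 0 _); apply/val_inj.
Qed.

Lemma operationE e e' c d t :
  (soc_prev (operation e e' c d t) = e) *
  (soc (operation e e' c d t) = e') *
  (charge (operation e e' c d t) = c) *
  (discharge (operation e e' c d t) = d) *
  (charging (operation e e' c d t) = t).
Proof.
by rewrite /soc_prev /soc /charge /discharge /charging !mxE.
Qed.

Lemma operation_combE (t : R) x y (z := t *: x + (1 - t) *: y) :
  (soc_prev z = t * soc_prev x + (1 - t) * soc_prev y) *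
  (soc z = t * soc x + (1 - t) * soc y) *
  (charge z = t * charge x + (1 - t) * charge y) *
  (discharge z = t * discharge x + (1 - t) * discharge y) *
  (charging z = t * charging x + (1 - t) * charging y).
Proof.
by rewrite /z /soc_prev /soc /charge /discharge /charging !mxE.
Qed.

Lemma convex_setP (A : set 'rV[R]_5) :
  convex_set A <->
  forall x y (t : R), 0 <= t <= 1 -> A x -> A y -> A (t *: x + (1 - t) *: y).
Proof.
split=> [cA x y t /andP[t0 t1] Ax Ay|cA x y t /set_mem Ax /set_mem Ay].
  by have /set_mem := cA x y (Itv01 t0 t1) (mem_set Ax) (mem_set Ay).
by apply/mem_set/cA => //; rewrite ge0 le1.
Qed.

Variables Emax Emin PC PD etaC etaD Delta : R.

Lemma TO_LP_convex : convex_set (TO_LP Emax Emin PC PD etaC etaD Delta).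
Proof.
apply/convex_setP => x y t t01.
move=> [bx [lx ux] [cx dx] [x1 x2 x3 x4] /andP[x5 x6]].
move=> [by_ [ly uy] [cy dy] [y1 y2 y3 y4] /andP[y5 y6]].
have L a b a' b' := @ler_combination _ t a b a' b' t01.
split; rewrite /soc_balance /power_limits /nonnegative_operation !operation_combE.
- by rewrite bx by_; ring.
- by have := L _ _ _ _ lx ly; have := L _ _ _ _ ux uy; split; lra.
- by have := L _ _ _ _ cx cy; have := L _ _ _ _ dx dy; split; lra.
- have := L _ _ _ _ x1 y1; have := L _ _ _ _ x2 y2.
  by have := L _ _ _ _ x3 y3; have := L _ _ _ _ x4 y4; split; lra.
- have := L _ _ _ _ x5 y5; have := L _ _ _ _ x6 y6.
  by move=> ? ?; apply/andP; split; lra.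
Qed.

Hypotheses (etaC0 : 0 < etaC) (etaD0 : 0 < etaD) (Delta0 : 0 < Delta).

(** A binary indicator forces one of the powers to vanish. One tightened inequality is then a plain
    bound on [soc_prev], and the other becomes, through the balance, a bound on [soc]. *)
Lemma BO_MIP_sub_TO_LP :
  BO_MIP Emax Emin PC PD etaC etaD Delta `<=`
  TO_LP Emax Emin PC PD etaC etaD Delta.
Proof.
move=> x [bx [/andP[e1 e2] /andP[e3 e4]] [cx dx] [x1 x2 x3 x4] t01].
have [c0|d0] : charge x = 0 \/ discharge x = 0.
- by case: t01 => t; [left|right]; move: cx dx; rewrite t; lra.
- move: bx; rewrite /soc_balance c0 mulr0 mul0r addr0 => bx.
  split => //; last by case: t01 => ->; rewrite lexx ler01.
  + by rewrite /soc_balance c0 mulr0 mul0r addr0.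
  + by rewrite c0; split; lra.
- move: bx; rewrite /soc_balance d0 mulr0 mul0r subr0 => bx.
  split => //; last by case: t01 => ->; rewrite lexx ler01.
  + by rewrite /soc_balance d0 mulr0 mul0r subr0.
  + by rewrite d0; split; lra.
Qed.

(** The energies [gC] and [gD] are nonnegative, so the tightened inequalities together with the
    balance keep both states of charge within [Emin] and [Emax]. *)
Lemma TO_LP_binary_BO_MIP x :
  charging x = 0 \/ charging x = 1 ->
  TO_LP Emax Emin PC PD etaC etaD Delta x ->
  BO_MIP Emax Emin PC PD etaC etaD Delta x.
Proof.
move=> t01 [bx [lx ux] [cx dx] [x1 x2 x3 x4] _].
have gC : 0 <= etaC * charge x * Delta by rewrite !mulr_ge0// ltW.
have gD : 0 <= etaD^-1 * discharge x * Delta by rewrite !mulr_ge0 ?invr_ge0// ltW.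
split => //; rewrite bx; split; apply/andP; split; lra.
Qed.

Hypothesis PC_le : PC <= (etaC * Delta)^-1 * (Emax - Emin).
Hypothesis PD_le : PD <= etaD / Delta * (Emax - Emin).

Lemma TO_LP_combination x : 0 <= Emin ->
  TO_LP Emax Emin PC PD etaC etaD Delta x -> 0 < charging x < 1 ->
  exists y z, [/\ BO_MIP Emax Emin PC PD etaC etaD Delta y,
                  BO_MIP Emax Emin PC PD etaC etaD Delta z &
                  x = charging x *: y + (1 - charging x) *: z].
Proof.
move=> Emin0 [bx [lx ux] [cx dx] [x1 x2 x3 x4] _] /andP[t0 t1].
set t := charging x in cx dx t0 t1 *.
have t'0 : 0 < 1 - t by rewrite subr_gt0.
pose u := charge x / t; pose v := discharge x / (1 - t).
have uE : charge x = t * u by rewrite mulrC divfK ?gt_eqF.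
have vE : discharge x = (1 - t) * v by rewrite mulrC divfK ?gt_eqF.
have u0 : 0 <= u by rewrite divr_ge0// ltW.
have v0 : 0 <= v by rewrite divr_ge0// ltW.
have uP : u <= PC by rewrite ler_pdivrMr.
have vP : v <= PD by rewrite ler_pdivrMr.
clearbody u v.
(* Energy gained by charging at power [u], and drained by discharging at power [v], over the
   period. *)
pose a := etaC * u * Delta; pose b := etaD^-1 * v * Delta.
have a0 : 0 <= a by rewrite !mulr_ge0// ltW.
have b0 : 0 <= b by rewrite !mulr_ge0 ?invr_ge0// ltW.
(* The power limits enter here: [aE] and [bE] make the two intervals of initial states nonempty. *)
have aE : a <= Emax - Emin.
  rewrite /a mulrAC mulrC -ler_pdivlMr ?mulr_gt0// mulrC.
  exact: le_trans PC_le.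
have bE : b <= Emax - Emin.
  have -> : b = v / (etaD / Delta) by rewrite /b invf_div; ring.
  rewrite ler_pdivrMr ?divr_gt0// mulrC.
  exact: le_trans PD_le.
(* Charging must start at most at [Emax - a] to end below [Emax]; discharging must start at least at
   [Emin + b] to end above [Emin]. *)
have [] := @itv_combination _ t Emin (Emax - a) (Emin + b) Emax (soc_prev x).
- by apply/andP; split; apply: ltW.
- by lra.
- by lra.
- by move: lx ux; rewrite uE vE /a /b => lx ux; apply/andP; split; lra.
move=> e [e' [/andP[e1 e2] /andP[e'1 e'2] eE]].
(* The final states [e + a] and [e' - b] are dictated by the balance. *)
exists (operation e (e + a) u 0 1), (operation e' (e' - b) 0 v 0); split.
- split; rewrite /soc_balance /power_limits /nonnegative_operation !operationE.
  + by rewrite /a; ring.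
  + by split; apply/andP; split; lra.
  + by split; lra.
  + by split; lra.
  + by right.
- split; rewrite /soc_balance /power_limits /nonnegative_operation !operationE.
  + by rewrite /b; ring.
  + by split; apply/andP; split; lra.
  + by split; lra.
  + by split; lra.
  + by left.
- apply: operation_ext; rewrite operation_combE !operationE.
  + exact: eE.
  + by rewrite bx eE uE vE /a /b; ring.
  + by rewrite uE; ring.
  + by rewrite vE; ring.
  + by rewrite -/t; ring.
Qed.

End Operations.

Theorem theorem1 (R : realType) (Emax Emin PC PD etaC etaD Delta : R)
    (hEmin : 0 <= Emin) (hE : Emin < Emax)
    (hDelta : 0 < Delta)
    (hetaC : 0 < etaC <= 1) (hetaD : 0 < etaD <= 1)
    (hPC : 0 <= PC <= (etaC * Delta)^-1 * (Emax - Emin))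
    (hPD : 0 <= PD <= etaD / Delta * (Emax - Emin)) :
  TO_LP Emax Emin PC PD etaC etaD Delta =
  convex_hull (BO_MIP Emax Emin PC PD etaC etaD Delta).
Proof.
have [/andP[etaC0 _] /andP[etaD0 _]] := (hetaC, hetaD).
have [/andP[_ PC_le] /andP[_ PD_le]] := (hPC, hPD).
apply/seteqP; split; last first.
  apply: smallest_sub; first exact: TO_LP_convex.
  exact: BO_MIP_sub_TO_LP.
(* Membership in the hull is tested against an arbitrary convex [C] containing the mixed-integer
   set. Binary indicators are split off because the decomposition divides by [charging x] and
   [1 - charging x]. *)
move=> x Px C [cC SC].
have [t0|t0] := eqVneq (charging x) 0.
  by apply: SC; apply: TO_LP_binary_BO_MIP => //; left.
have [t1|t1] := eqVneq (charging x) 1.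
  by apply: SC; apply: TO_LP_binary_BO_MIP => //; right.
have t01 : 0 < charging x < 1.
  by case: Px => _ _ _ _ /andP[? ?]; rewrite !lt_neqAle eq_sym t0 t1; apply/andP.
have [y [z [Sy Sz ->]]] :=
  TO_LP_combination etaC0 etaD0 hDelta PC_le PD_le hEmin Px t01.
move/convex_setP: cC => cC; apply: cC; [|exact: SC|exact: SC].
by case/andP: t01 => /ltW -> /ltW ->.
Qed.
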